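(* Let $v\in(0,1)$ and $b\in\mathbb{N}_0$, and assume $E[C_1]<\infty$. The expected discounted dividends $V_D^b(x):=E_x^{[0,b]}\sum_{l=0}^\infty v^lr(l)$ of the process doubly reflected at $0$ and $b$ satisfy, for $x\in\mathbb{Z}$, $$V_D^b(x)=\begin{cases}\dfrac{Z_v(x)}{\Delta Z_v(b)}, & x\le b,\\[2mm] x-b+V_D^b(b), & x>b.\end{cases}$$
   Context: Notation: $\mathbb{N}=\{1,2,\dots\}$, $\mathbb{N}_0=\{0,1,2,\dots\}$; $E[Y;A]:=E[Y\mathbf{1}_A]$; $\inf\emptyset=\infty$; $\Delta f(k):=f(k+1)-f(k)$ for $f:\mathbb{N}_0\to\mathbb{R}$, $k\in\mathbb{N}_0$. Let $(p_k)_{k\in\mathbb{N}_0}$ be a probability mass function on $\mathbb{N}_0$ with $p_0>0$, and let $C_1,C_2,\dots$ be i.i.d. with $P(C_1=k)=p_k$. Let $X_n=X_0+n-\sum_{i=1}^nC_i$, $n\in\mathbb{N}_0$; for $x\in\mathbb{Z}$, $P_x$ (expectation $E_x$) is the law under which $X_0=x$, and $P=P_0$, $E=E_0$. For $b\in\mathbb{Z}$ let $\tau_b^-=\inf\{n\in\mathbb{N}_0:X_n\le b\}$ and $\tau_b^+=\inf\{n\in\mathbb{N}_0:X_n\ge b\}$. For $v\in(0,1]$: $W_v(y):=\big(p_0E[v^{\tau_y^+};\tau_y^+<\tau_{-1}^-]\big)^{-1}$ for $y\in\mathbb{N}_0$, and $W_v(y):=0$ for integers $y<0$; $Z_v(x)=1+\left(\frac1v-1\right)\sum_{y=0}^{x-1}W_v(y)$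 for $x\in\mathbb{N}_0$, and $Z_v(x)=1$ for integers $x<0$. Doubly reflected surplus process: fix $b\in\mathbb{N}_0$ and initial capital $x\in\mathbb{Z}$. At time $0$ capital $r_*(0)=\max(-x,0)$ is injected and the dividend $r(0)=\max(x-b,0)$ is paid, so the surplus is $\tilde X_0=x+r_*(0)-r(0)$. In period $l\in\mathbb{N}$, put $y_l=\tilde X_{l-1}+1-C_l$; at the end of the period capital $r_*(l)=\max(-y_l,0)$ is injected and dividend $r(l)=\max(y_l-b,0)$ is paid, so $\tilde X_l=y_l+r_*(l)-r(l)$. $E_x^{[0,b]}$ denotes expectation for this process with initial capital $x$. *)

(* Defs.v *)
From mathcomp Require Import all_boot all_order all_algebra finmap.
From mathcomp Require Import all_classical all_reals all_analysis.

Set Implicit Arguments.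
Unset Strict Implicit.
Unset Printing Implicit Defensive.

Import Order.TTheory GRing.Theory Num.Theory.

Local Open Scope classical_set_scope.
Local Open Scope ring_scope.

Definition fdiff (R : realType) (f : nat -> R) (k : nat) : R := f k.+1 - f k.

Definition is_pmf (R : realType) (p : nat -> R) : Prop :=
  (forall k, 0 <= p k) /\ (\sum_(0 <= k <oo) (p k)%:E = 1)%E.

(* Mutual independence of a family: the product rule over every finite
   subfamily *)
Definition mutually_independent d d' (T : measurableType d)
    (T' : measurableType d') (R : realType) (P : probability T R)
    (I : choiceType) (X : I -> {RV P >-> T'}) : Prop :=
  forall (J : {fset I}) (A : I -> set T'), (forall i, measurable (A i)) ->
    P (\bigcap_(i in [set` J]) (X i @^-1` A i)) =
    (\prod_(i <- J) P (X i @^-1` A i))%E.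

(* [C i] is the claim $C_{i+1}$ of period i + 1. The probability space is
   fixed and carries the claims only: the law $P_x$ is encoded by the explicit
   initial value x of the processes below. *)
Definition iid_claims d (T : measurableType d) (R : realType)
    (P : probability T R) (p : nat -> R) (C : nat -> {RV P >-> nat}) : Prop :=
  mutually_independent C /\
  (forall i k : nat, P (C i @^-1` [set k]) = (p k)%:E).

(* The infimum is taken in [\bar R], so that the infimum of the empty set
   is [+oo] *)
Definition first_time (R : realType) (A : set nat) : \bar R :=
  ereal_inf [set n%:R%:E | n in A].

Section surplus.
Context d (T : measurableType d) (R : realType) (P : probability T R).
Variables (p : nat -> R) (C : nat -> {RV P >-> nat}).

Definition walk (x : int) (n : nat) (w : T) : int :=
  x + n%:Z - \sum_(i < n) (C i w)%:Z.

Definition tau_minus (x b : int) (w : T) : \bar R :=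
  first_time R [set n | walk x n w <= b].

Definition tau_plus (x b : int) (w : T) : \bar R :=
  first_time R [set n | b <= walk x n w].

(* $E[v^{\tau_y^+}; \tau_y^+ < \tau_{-1}^-]$ under $P = P_0$; on the event,
   $\tau_y^+$ is a natural number, hence [fine] is harmless. *)
Definition exit_above (v : R) (y : int) : \bar R :=
  'E_P[(fun w => v `^ fine (tau_plus 0 y w) *
          \1_[set w' | (tau_plus 0 y w' < tau_minus 0 (-1) w')%E] w)%R]%E.

(* [exit_above v y] lies in [0, 1] when 0 < v <= 1, hence [fine] is harmless *)
Definition W (v : R) (y : int) : R :=
  if y is Posz _ then (p 0%N * fine (exit_above v y))^-1 else 0.

Definition Z (v : R) (x : int) : R :=
  if x is Posz n then 1 + (v^-1 - 1) * \sum_(0 <= y < n) W v y%:Z else 1.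

Definition injection (y : int) : int := Num.max (- y) 0.

Definition dividend (b : nat) (y : int) : int := Num.max (y - b%:Z) 0.

Definition regulate (b : nat) (y : int) : int :=
  y + injection y - dividend b y.

(* $y_l$ for l >= 1, and the initial capital x for l = 0; the doubly
   reflected surplus $\tilde X_l$ is [regulate b (pre_reflected b x l w)]. *)
Fixpoint pre_reflected (b : nat) (x : int) (l : nat) (w : T) : int :=
  if l is l'.+1 then regulate b (pre_reflected b x l' w) + 1 - (C l' w)%:Z
  else x.

Definition dividend_at (b : nat) (x : int) (l : nat) (w : T) : int :=
  dividend b (pre_reflected b x l w).

Definition expected_dividends (v : R) (b : nat) (x : int) : \bar R :=
  (\int[P]_w \sum_(0 <= l <oo) (v ^+ l * (dividend_at b x l w)%:~R)%:E)%E.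

End surplus.

(* Main.v *)
Require Import Defs.
From mathcomp Require Import all_boot all_order all_algebra finmap.
From mathcomp Require Import all_classical all_reals all_analysis.
From mathcomp Require Import measurable_realfun ring lra zify.

Import Order.TTheory GRing.Theory Num.Theory.
Import numFieldNormedType.Exports.

Local Open Scope classical_set_scope.
Local Open Scope ring_scope.

(** The proof evaluates expected discounted rewards of a Markov chain driven by
    the claims, twice, by the same principle ([discounted_rewards]): if a chain
    S starts at x and moves by S_{n+1} = F(S_n, C_n), and if r >= 0 and a
    bounded u >= 0 satisfy u(s) = v E[u(F(s,C)) + r(F(s,C))] for all s, then
    v^n E[u(S_n)] is the sum of v^{n+1} E[r(S_{n+1})] and v^{n+1} E[u(S_{n+1})];
    telescoping, with v^n E[u(S_n)] -> 0, gives
    E[sum_n v^n r(S_n)] = r(x) + u(x).  The probabilistic input is that C_n is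
    independent of the past C_0,...,C_{n-1}
    ([integral_chainS]).

    Let w be the sequence with p_0 w(0) = 1 and
    sum_{k <= n+1} p_k w(n+1-k) = w(n)/v; it is positive and nondecreasing.

    The walk killed on leaving [0,y), rewarded by 1 at its (at most one) visit
    to y, has discounted reward E[v^{tau_y^+}; tau_y^+ < tau_{-1}^-], because
    the walk climbs by at most one unit per step.  The function w(s)/w(y) on
    [0,y), extended by 0, solves its equation, so the expectation is w(0)/w(y)
    and W_v = w ([W_scale]).  Summing the recursion of w then gives
    Z_v(n) = v sum_k p_k Z_v(n+1-k) for all n >= 0 ([series_Z]).

    For the doubly reflected process the reward is the dividend, and
    u(s) = Z_v(s')/Delta Z_v(b), with s' the surplus after regulation, solves
    the equation: for t <= b+1 the sum of u(t) and the dividend at t is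
    Z_v(t)/Delta Z_v(b), since Z_v = 1 below 0 and the unit dividend paid at
    b+1 is the increment (Z_v(b+1) - Z_v(b))/Delta Z_v(b). *)

(** * Integration of functions of a countably valued map *)

Section countably_valued.
Context {d : measure_display} {T : measurableType d} {R : realType}.
Context {K : countType} {h : T -> K}.
Hypothesis hm : forall k, measurable (h @^-1` [set k]).

Lemma measurable_fun_fibers d' (T' : measurableType d') (g : K -> T') :
  measurable_fun setT (g \o h).
Proof.
move=> _ B mB; rewrite setTI.
rewrite (_ : _ @^-1` _ = \bigcup_k [set w | h w = k /\ B (g k)]).
  apply: countable_bigcupT_measurable; first exact: countableP.
  move=> k; have [Bk|nBk] := pselect (B (g k)).
    by rewrite (_ : [set w | _] = h @^-1` [set k])//;
      apply/seteqP; split=> w //= -[].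
  by rewrite (_ : [set w | _] = set0)//; apply/seteqP; split=> w //= -[].
apply/seteqP; split=> [w Bw|w [k _ [<-]]]//.
by exists (h w).
Qed.

(** Independence of the event D from the countably many values of h, in the
    form used for integrals; c stands for the probability of D. *)
Lemma integral_indep_fibers (mu : {measure set T -> \bar R}) (D : set T)
    (c : R) (g : K -> \bar R) :
  measurable D -> (forall k, 0 <= g k)%E ->
  (forall k, mu (D `&` h @^-1` [set k]) = c%:E * mu (h @^-1` [set k]))%E ->
  (\int[mu]_(w in D) g (h w) = c%:E * \int[mu]_w g (h w))%E.
Proof.
move=> mD g0 indep.
pose H j := [set w | choice.pickle (h w) = j].
(* Indexing the fibers by [nat] makes some of them empty. *)
have HE j : H j = set0 \/ exists k, H j = h @^-1` [set k].
  have [[w Hw]|nH] := pselect (exists w, H j w); [right|left].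
    exists (h w); apply/seteqP; split=> w' /=; rewrite /H/=; last by move=> ->.
    by rewrite -Hw => /(pcan_inj choice.pickleK).
  by apply/seteqP; split=> w // Hw; apply: nH; exists w.
have mH j : measurable (H j) by case: (HE j) => [->//|[k ->]].
have HT : \bigcup_j H j = setT.
  by apply/seteqP; split=> w // _; exists (choice.pickle (h w)).
have mgh : measurable_fun setT (fun w => g (h w)) by exact: measurable_fun_fibers.
have tH : trivIset setT H by move=> i j _ _ [w [/= <- <-]].
have -> : D = \bigcup_j (D `&` H j) by rewrite -setI_bigcupr HT setIT.
rewrite ge0_integral_bigcup//; first last.
- exact: trivIset_setIl.
- by apply: measurable_funS mgh => //; exact: subsetT.
- by move=> j; exact: measurableI.
rewrite -[in RHS]HT ge0_integral_bigcup//; last first.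
  by apply: measurable_funS mgh => //; exact: subsetT.
rewrite -nneseriesZl; last by move=> *; exact: integral_ge0.
apply: eq_eseriesr => j _; case: (HE j) => [->|[k Hk]].
  by rewrite setI0 !integral_set0 mule0.
have cst : forall A, A `<=` H j ->
    (\int[mu]_(w in A) g (h w) = \int[mu]_(w in A) g k)%E.
  by move=> A AH; apply: eq_integral => w /set_mem/AH; rewrite Hk => ->.
rewrite !cst//.
rewrite !integral_cst//; last exact: measurableI.
by rewrite Hk indep muleCA.
Qed.

End countably_valued.

(** * Chains driven by the claims *)

Fixpoint chain {T K : Type} (C : nat -> T -> nat)
    (F : K -> nat -> K) (x : K) (n : nat) (w : T) : K :=
  if n is n'.+1 then F (chain C F x n' w) (C n' w) else x.

(** A chain may have an arbitrary state type; all that happens before time n is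
    a function of this countably valued map. *)
Definition past {T : Type} (C : nat -> T -> nat) (n : nat)
  (w : T) : seq nat := mkseq (C^~ w) n.

Lemma chain_past {T K : Type} (C : nat -> T -> nat)
  (F : K -> nat -> K) (x : K) (n : nat) :
  chain C F x n = foldl F x \o past C n.
Proof.
apply/funext => w /=; elim: n => // n IHn.
by rewrite [past _ _ _]mkseqS foldl_rcons /= IHn.
Qed.

Section iid.
Context {d : measure_display} {T : measurableType d} {R : realType}.
Context {P : probability T R} {p : nat -> R} {C : nat -> {RV P >-> nat}}.
Hypothesis hC : iid_claims p C.

Lemma measurable_claim n (A : set nat) : measurable (C n @^-1` A).
Proof. by rewrite -[_ @^-1` _]setTI; exact: measurable_funP. Qed.

Lemma past_bigcap n (s : seq nat) : size s = n ->
  past C n @^-1` [set s] =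
  \bigcap_(i in [set` [fset i in iota 0 n]%fset]) (C i @^-1` [set nth 0%N s i]).
Proof.
move=> sz; apply/seteqP; split=> [w /= <- i /=|w /= H].
  by rewrite in_fset/= mem_iota/= add0n => ilt; rewrite nth_mkseq.
apply: (@eq_from_nth _ 0%N); first by rewrite size_mkseq.
rewrite size_mkseq => i ilt; rewrite nth_mkseq//.
by apply: (H i); rewrite /= in_fset/= mem_iota.
Qed.

Lemma measurable_past n s : measurable (past C n @^-1` [set s]).
Proof.
have [sz|sz] := eqVneq (size s) n; last first.
  rewrite (_ : _ @^-1` _ = set0)//; apply/seteqP; split=> w //= ws.
  by move: sz; rewrite -ws size_mkseq eqxx.
rewrite past_bigcap//; apply: fin_bigcap_measurable => // i _.
exact: measurable_claim.
Qed.

(** The product rule for the claims up to n, divided by the one for the claims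
    before n. *)
Lemma claim_indep_past n k s :
  (P (C n @^-1` [set k] `&` past C n @^-1` [set s]) =
   (p k)%:E * P (past C n @^-1` [set s]))%E.
Proof.
have [sz|sz] := eqVneq (size s) n; last first.
  rewrite (_ : past C n @^-1` _ = set0) ?setI0 ?measure0 ?mule0//.
  apply/seteqP; split=> w //= ws.
  by move: sz; rewrite -ws size_mkseq eqxx.
have [indep law] := hC.
pose J := [fset i in iota 0 n]%fset.
pose A i := if i == n then [set k] else [set nth 0%N s i].
have nJ : n \notin J by rewrite in_fset/= mem_iota/= add0n ltnn.
have AJ i : i \in J -> A i = [set nth 0%N s i].
  by rewrite in_fset/= mem_iota/= add0n /A ltn_neqAle => /andP[/negbTE ->].
have -> : past C n @^-1` [set s] = \bigcap_(i in [set` J]) (C i @^-1` A i).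
  by rewrite past_bigcap//; apply: eq_bigcapr => i /= /AJ ->.
rewrite indep// -(law n) (_ : C n @^-1` [set k] `&` _ =
    \bigcap_(i in [set` (n |` J)%fset]) (C i @^-1` A i)); last first.
  apply/seteqP; split=> [w [wk wJ] i /=|w H].
    by rewrite in_fset1U => /orP[/eqP ->|/wJ//]; rewrite /A eqxx.
  split; first by have := H n; rewrite /= in_fset1U eqxx /A eqxx; apply.
  by move=> i iJ; apply: H; rewrite /= in_fset1U; apply/orP; right.
by rewrite indep// big_fsetU1//= {1}/A eqxx.
Qed.

Context {K : Type} (F : K -> nat -> K) (x : K).

Lemma measurable_chain (f : K -> \bar R) n :
  measurable_fun setT (fun w => f (chain C F x n w)).
Proof.
rewrite chain_past.
exact: (measurable_fun_fibers (measurable_past n) _ _ (f \o foldl F x)).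
Qed.

Hypothesis hp : is_pmf p.

(** One step of the Markov property: split according to the value of C_n, which
    is independent of the state at time n. *)
Lemma integral_chainS (f : K -> \bar R) n : (forall s, 0 <= f s)%E ->
  (\int[P]_w f (chain C F x n.+1 w) =
   \int[P]_w \sum_(0 <= k <oo) ((p k)%:E * f (F (chain C F x n w) k)))%E.
Proof.
move=> f0.
have p0 k : (0 <= (p k)%:E)%E by rewrite lee_fin; exact: hp.1.
rewrite integral_nneseries//; first last.
- by move=> k w _; apply: mule_ge0.
- move=> k.
  exact: (measurable_chain (fun s => (p k)%:E * f (F s k))%E).
have CT : \bigcup_k (C n @^-1` [set k]) = setT.
  by apply/seteqP; split=> w // _; exists (C n w).
rewrite -[in LHS]CT ge0_integral_bigcup//; first last.
- by move=> i j _ _ [w [/= <- <-]].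
- by rewrite CT; exact: measurable_chain.
- by move=> k; exact: measurable_claim.
apply: eq_eseriesr => k _.
rewrite ge0_integralZl//; last exact: (measurable_chain (fun s => f (F s k))).
rewrite (eq_integral (fun w => f (F (chain C F x n w) k))); last first.
  by move=> w /set_mem /= ->.
rewrite chain_past.
apply: (integral_indep_fibers (measurable_past n) _ _ (p k)
  (fun s => f (F (foldl F x s) k))) => //.
- exact: measurable_claim.
- by move=> s; exact: claim_indep_past.
Qed.

(** Since u is bounded and v < 1, the equation for u telescopes along the chain
    with a remainder that vanishes in the limit. *)
Lemma discounted_rewards (v B : R) (u r : K -> R) :
  0 < v -> v < 1 -> (forall s, 0 <= u s <= B) -> (forall s, 0 <= r s) ->
  (forall s, \sum_(0 <= k <oo) (p k * (u (F s k) + r (F s k)))%:E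
             = (u s / v)%:E)%E ->
  (\int[P]_w \sum_(0 <= n <oo) (v ^+ n * r (chain C F x n w))%:E
   = (r x + u x)%:E)%E.
Proof.
move=> v0 v1 uB r0 harm.
pose U n := (\int[P]_w (u (chain C F x n w))%:E)%E.
pose D n := (\int[P]_w (v ^+ n * r (chain C F x n w))%:E)%E.
have u0 s : 0 <= u s by case/andP: (uB s).
have vn0 n : 0 <= v ^+ n by rewrite exprn_ge0// ltW.
have D0 n : (0 <= D n)%E.
  by apply: integral_ge0 => w _; rewrite lee_fin mulr_ge0.
have U0 n : (0 <= U n)%E by apply: integral_ge0 => w _; rewrite lee_fin.
have UB n : (U n <= B%:E)%E.
  apply: (@le_trans _ _ (\int[P]_w B%:E)%E).
    apply: ge0_le_integral => //.
    - by move=> w _; rewrite lee_fin.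
    - exact: (measurable_chain (fun s => (u s)%:E)).
    - by move=> w _; rewrite lee_fin; case/andP: (uB (chain C F x n w)).
  by rewrite integral_cst//= probability_setT mule1.
have Ufin n : U n \is a fin_num.
  by rewrite ge0_fin_numE//; exact: le_lt_trans (UB n) (ltry _).
have step n : ((v ^+ n)%:E * U n = (v ^+ n.+1)%:E * U n.+1 + D n.+1)%E.
  have -> : D n.+1
      = ((v ^+ n.+1)%:E * \int[P]_w (r (chain C F x n.+1 w))%:E)%E.
    rewrite -ge0_integralZl ?lee_fin//.
    - exact: (measurable_chain (fun s => (r s)%:E)).
    - by move=> w _; rewrite lee_fin.
  rewrite -ge0_muleDr//; last by apply: integral_ge0 => w _; rewrite lee_fin.
  rewrite /U -ge0_integralD//; first last.
  - exact: (measurable_chain (fun s => (r s)%:E)).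
  - by move=> w _; rewrite lee_fin.
  - exact: (measurable_chain (fun s => (u s)%:E)).
  - by move=> w _; rewrite lee_fin.
  rewrite (integral_chainS (fun s => (u s)%:E + (r s)%:E)%E); last first.
    by move=> s; rewrite -EFinD lee_fin addr_ge0.
  rewrite [in RHS](eq_integral
    (fun w => (v^-1)%:E * (u (chain C F x n w))%:E)%E); last first.
    by move=> w _; rewrite -EFinM [v^-1 * _]mulrC -harm.
  rewrite ge0_integralZl ?lee_fin ?invr_ge0 ?(ltW v0)//; first last.
  - by move=> w _; rewrite lee_fin.
  - exact: (measurable_chain (fun s => (u s)%:E)).
  by rewrite muleA -EFinM exprS mulrAC divff ?gt_eqF// mul1r.
(* The N steps from time 0 to time N, telescoped. *)
have partial N : (\sum_(0 <= n < N) D n.+1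
    = (u x - v ^+ N * fine (U N))%:E)%E.
  elim: N => [|N IHN].
    rewrite big_geq// /U/= integral_cst//= probability_setT mule1/=.
    by rewrite expr0 mul1r subrr.
  have := step N; rewrite -{1}(fineK (Ufin N)) -(fineK (Ufin N.+1)) -!EFinM.
  move=> E; have Dfin : D N.+1 \is a fin_num.
    by move: E; case: (D N.+1).
  move: E; rewrite big_nat_recr//= IHN -(fineK Dfin) -!EFinD => -[->].
  by congr EFin; ring.
have -> : (\int[P]_w \sum_(0 <= n <oo) (v ^+ n * r (chain C F x n w))%:E
    = \sum_(0 <= n <oo) D n)%E.
  rewrite integral_nneseries//.
  - by move=> n; exact: (measurable_chain (fun s => (v ^+ n * r s)%:E)).
  - by move=> n w _; rewrite lee_fin mulr_ge0.
rewrite nneseries_recl//.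
have -> : D 0%N = (r x)%:E.
  by rewrite /D/= integral_cst//= probability_setT mule1/= expr0 mul1r.
rewrite EFinD; congr (_ + _)%E.
rewrite -nneseries_addn//.
apply/cvg_lim => //.
rewrite (_ : (fun N => _) = (fun N => (u x - v ^+ N * fine (U N))%:E)).
  apply: cvg_EFin; first by near=> N.
  rewrite -[X in _ --> X]subr0; apply: cvgB; first exact: cvg_cst.
  apply: (@squeeze_cvgr _ _ _ _ (fun=> 0) (fun N => v ^+ N * B)).
  - near=> N; rewrite mulr_ge0 ?fine_ge0//= ler_wpM2l//.
    by rewrite -lee_fin fineK.
  - exact: cvg_cst.
  - rewrite -[X in _ --> X](mul0r B); apply: cvgMl.
    by apply: cvg_expr; rewrite ger0_norm// ltW.
by apply/funext => N; rewrite -partial; apply: eq_bigr => i _; rewrite addn1.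
Unshelve. all: by end_near.
Qed.

End iid.

(** * The scale sequence *)

Definition convolution {R : realType} (p f : nat -> R) (n : nat) : R :=
  \sum_(k < n.+1) p k * f (n - k)%N.

(** Scale functions vanish on the negative integers. *)
Definition zero_ext {R : realType} (f : nat -> R) (t : int) : R :=
  if t is Posz n then f n else 0.

Section scale_sequence.
Context {R : realType} {p : nat -> R}.
Hypothesis hp : is_pmf p.

Lemma pmf_sum_le1 n : \sum_(k < n) p k <= 1.
Proof.
rewrite -lee_fin -hp.2 -sumEFin -(big_mkord xpredT (fun k => (p k)%:E)).
by apply: nneseries_lim_ge => k _ _; rewrite lee_fin; exact: hp.1.
Qed.

(** The terms with k > n vanish, so that E[f(n-C)] is a finite sum. *)
Lemma series_convolution (f : nat -> R) n : (forall k, 0 <= f k) ->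
  (\sum_(0 <= k <oo) (p k * zero_ext f (n%:Z - k%:Z))%:E = (convolution p f n)%:E)%E.
Proof.
move=> f0; have ext0 t : 0 <= zero_ext f t by case: t => //=.
rewrite (nneseries_split _ n.+1); last first.
  by move=> k _; rewrite lee_fin mulr_ge0//; exact: hp.1.
rewrite add0n eseries0 ?adde0; last first.
  move=> k nk _; rewrite (_ : n%:Z - k%:Z = Negz (k - n.+1)) ?mulr0//.
  by rewrite NegzE; lia.
rewrite big_mkord sumEFin /convolution; congr EFin; apply: eq_bigr => k _.
by rewrite subzn// -ltnS.
Qed.

Hypothesis hp0 : 0 < p 0%N.

Section recursion.
Context {v : R} {w : nat -> R}.
Hypotheses (v0 : 0 < v) (v1 : v < 1).
Hypotheses (w0 : convolution p w 0 = 1) (wS : forall n, convolution p w n.+1 = w n / v).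

Lemma scale0 : p 0%N * w 0%N = 1.
Proof. by rewrite -w0 /convolution big_ord1. Qed.

(** Positivity and monotonicity are proved together: if w is at most w(n)
    up to n, the terms k >= 1 of the recursion sum to at most (1-p_0) w(n), so
    p_0 w(n+1) >= w(n)/v - (1-p_0) w(n) >= p_0 w(n). *)
Lemma scale_gt0_le n : 0 < w n /\ forall m, (m <= n)%N -> w m <= w n.
Proof.
elim: n => [|n [wn IH]].
  split; last by move=> m; rewrite leqn0 => /eqP ->.
  by rewrite -(pmulr_rgt0 _ hp0) scale0.
suff le : w n <= w n.+1.
  split; first exact: lt_le_trans le.
  by move=> m; rewrite leq_eqVlt ltnS => /orP[/eqP ->//|/IH /le_trans]; apply.
rewrite -(ler_pM2l hp0).
have := wS n; rewrite /convolution big_ord_recl subn0 => E.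
have tail : \sum_(i < n.+1) p (lift ord0 i) * w (n.+1 - lift ord0 i)%N
    <= (1 - p 0%N) * w n.
  apply: (@le_trans _ _ (\sum_(i < n.+1) p i.+1 * w n)).
    apply: ler_sum => i _; rewrite ler_wpM2l//; first exact: hp.1.
    by rewrite IH//= /bump/=; lia.
  rewrite -mulr_suml ler_pM2r// lerBrDl.
  by have := pmf_sum_le1 n.+2; rewrite big_ord_recl.
have : w n <= w n / v by rewrite ler_pdivlMr// ler_piMr ?ltW.
by move: E tail; rewrite /= => E tail; lra.
Qed.

Lemma scale_gt0 n : 0 < w n. Proof. exact: (scale_gt0_le n).1. Qed.

Lemma scale_nondecreasing m n : (m <= n)%N -> w m <= w n.
Proof. exact: (scale_gt0_le n).2. Qed.

(** Discrete integration of the recursion of w: the increment in n of the left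
    side is the convolution of p with w. *)
Lemma convolution_sum_scale n :
  convolution p (fun m => \sum_(0 <= y < m) w y) n.+1
  = 1 + (\sum_(0 <= y < n) w y) / v.
Proof.
have step m : convolution p (fun m => \sum_(0 <= y < m) w y) m.+1
    = convolution p (fun m => \sum_(0 <= y < m) w y) m + convolution p w m.
  rewrite /convolution big_ord_recr/= subnn big_geq// mulr0 addr0 -big_split/=.
  apply: eq_bigr => i _; rewrite -mulrDr subSn; last by rewrite -ltnS.
  by rewrite big_nat_recr.
elim: n => [|n IHn]; rewrite step.
  by rewrite {1}/convolution big_ord1 subnn big_geq// mulr0 add0r w0 mul0r addr0.
by rewrite IHn wS big_nat_recr//= mulrDl addrA.
Qed.

End recursion.

(** The recursion of w has full history, so the list of all values
    w(n),...,w(0) is iterated. *)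
Lemma scale_exists (v : R) :
  exists w, convolution p w 0 = 1 /\ forall n, convolution p w n.+1 = w n / v.
Proof.
pose next (s : seq R) :=
  (s`_0 / v - \sum_(k < size s) p k.+1 * s`_k) / p 0%N.
pose vals n := iter n (fun s => next s :: s) [:: (p 0%N)^-1].
pose w n := (vals n)`_0.
have size_vals n : size (vals n) = n.+1 by elim: n => //= n ->.
have nth_vals n k : (k <= n)%N -> (vals n)`_k = w (n - k)%N.
  elim: n k => [|n IHn] [|k]//= kn.
  by rewrite subSS IHn.
have p0n : p 0%N != 0 by rewrite gt_eqF.
exists w; split=> [|n]; first by rewrite /convolution big_ord1/= divff.
rewrite /convolution big_ord_recl subn0.
have -> : p ord0 * w n.+1 = w n / v - \sum_(k < n.+1) p k.+1 * (vals n)`_k.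
  by rewrite /w/= /next size_vals mulrC divfK.
rewrite [X in _ + X](eq_bigr (fun k : 'I_n.+1 => p k.+1 * (vals n)`_k)) ?subrK//.
by move=> k _; rewrite lift0 subSS nth_vals// -ltnS.
Qed.

End scale_sequence.

(** * First passage and the killed walk *)

Lemma first_time_least {R : realType} {A : set nat} {n} :
  A n -> (forall m, A m -> (n <= m)%N) -> first_time R A = n%:R%:E.
Proof.
move=> An least; apply/le_anti/andP; split.
  by apply: ereal_inf_lbound; exists n.
by apply/ereal_infP => _ [m /least nm <-]; rewrite lee_fin ler_nat.
Qed.

Lemma lt_first_time {R : realType} {A : set nat} {n} :
  (n%:R%:E < first_time R A)%E <-> (forall m, A m -> (n < m)%N).
Proof.
split=> [lt m Am|lt].
  rewrite -(@ltr_nat R) -lte_fin; apply: (lt_le_trans lt).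
  by apply: ereal_inf_lbound; exists m.
apply: (@lt_le_trans _ _ n.+1%:R%:E); first by rewrite lte_fin ltr_nat.
by apply/ereal_infP => _ [m /lt nm <-]; rewrite lee_fin ler_nat.
Qed.

Lemma first_time_lt {R : realType} {A : set nat} {c : \bar R} :
  (first_time R A < c)%E ->
  exists n, A n /\ (forall m, A m -> (n <= m)%N).
Proof.
move=> lt; have [[n0 An0]|nA] := pselect (exists n, A n).
  have ex : exists n, `[< A n >] by exists n0; apply/asboolP.
  case: (ex_minnP ex) => n /asboolP An least; exists n; split=> // m Am.
  by apply: least; apply/asboolP.
move: lt.
rewrite /first_time (_ : [set n%:R%:E | n in A] = set0 :> set (\bar R)).
  by rewrite ereal_inf0 ltNge leey.
by apply/seteqP; split=> // t [n An _]; apply: nA; exists n.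
Qed.

(** One step of the walk killed on leaving [0,y).  The state -1 is absorbing and
    a visit to y is followed by -1, so y is visited at most once. *)
Definition kill (y : nat) (s : int) (k : nat) : int :=
  if 0 <= s < y%:Z then s + 1 - k%:Z else -1.

Section exit.
Context {d : measure_display} {T : measurableType d} {R : realType}.
Context {P : probability T R} {p : nat -> R} {C : nat -> {RV P >-> nat}}.

Lemma walkS x n w : walk C x n.+1 w = walk C x n w + 1 - (C n w)%:Z.
Proof.
rewrite /walk big_ord_recr/= -[n.+1]addn1 PoszD opprD !addrA.
by congr (_ - _); rewrite addrAC.
Qed.

Lemma chain_kill y n w : (forall i, (i < n)%N -> 0 <= walk C 0 i w < y%:Z) ->
  chain C (kill y) 0 n w = walk C 0 n w.
Proof.
elim: n => [|n IHn] alive; first by rewrite /walk big_ord0.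
rewrite /= IHn; last by move=> i ?; apply: alive; lia.
by rewrite /kill alive// walkS.
Qed.

Lemma chain_kill_ge0 y n w : 0 <= chain C (kill y) 0 n w ->
  forall i, (i < n)%N -> 0 <= walk C 0 i w < y%:Z.
Proof.
elim: n => [//|n IHn] /=; rewrite /kill; case: ifP => // sn _ i.
have alive := IHn (proj1 (andP sn)).
rewrite ltnS leq_eqVlt => /orP[/eqP ->|/alive//].
by rewrite -(chain_kill y).
Qed.

(** The killed walk visits y exactly when tau_y^+ < tau_{-1}^-, and then at time
    tau_y^+: upward steps have size at most one, so the walk cannot jump over y.
    On the complement, including the case where both times are infinite, both
    sides are 0. *)
Lemma exit_as_reward (v : R) (y : nat) w : 0 <= v ->
  ((v `^ fine (tau_plus C 0 y%:Z w) *
     \1_[set w' | (tau_plus C 0 y%:Z w' < tau_minus C 0 (-1) w')%E] w)%:E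
   = \sum_(0 <= n <oo) (v ^+ n * (chain C (kill y) 0 n w == y%:Z)%:R)%:E)%E.
Proof.
move=> v0; set S := fun n => chain C (kill y) 0 n w.
have visit n : S n = y%:Z ->
    walk C 0 n w = y%:Z /\ forall i, (i < n)%N -> 0 <= walk C 0 i w < y%:Z.
  move=> Sn; have alive : forall i, (i < n)%N -> 0 <= walk C 0 i w < y%:Z.
    by apply: chain_kill_ge0; rewrite -/(S n) Sn.
  by split=> //; rewrite -(chain_kill y).
have [[n Sn]|nS] := pselect (exists n, S n = y%:Z).
  have [wn alive] := visit _ Sn.
  have tauE : tau_plus C 0 y%:Z w = n%:R%:E.
    apply: first_time_least; rewrite /= ?wn// => m ym.
    by rewrite leqNgt; apply/negP => /alive; lia.
  have lt : (tau_plus C 0 y%:Z w < tau_minus C 0 (-1) w)%E.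
    rewrite tauE; apply/lt_first_time => m /= wm.
    rewrite ltnNge leq_eqVlt; apply/negP => /orP[/eqP E|/alive]; last by lia.
    by move: wm; rewrite E wn.
  rewrite indicE mem_set// mulr1 tauE/= powR_mulrn//.
  rewrite (nneseriesD1 (n := n))//; last first.
    by move=> k _; rewrite lee_fin mulr_ge0// exprn_ge0.
  rewrite -/(S n) Sn eqxx mulr1 eseries0 ?adde0// => m _ mn.
  rewrite -/(S m); have [Sm|] := eqVneq (S m) y%:Z; last by rewrite mulr0.
  have [wm alivem] := visit _ Sm.
  have [mltn|nltm|E] := ltngtP m n; last by rewrite E eqxx in mn.
  - by have := alive _ mltn; lia.
  - by have := alivem _ nltm; lia.
rewrite eseries0; last first.
  move=> n _ _; rewrite -/(S n); have [Sn|] := eqVneq (S n) y%:Z.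
    by case: nS; exists n.
  by rewrite mulr0.
rewrite indicE memNset ?mulr0// => /= lt.
have [n [/= yn least]] := first_time_lt lt.
move: lt; rewrite {1}/tau_plus (first_time_least yn least).
move=> /lt_first_time later.
have alive i : (i < n)%N -> 0 <= walk C 0 i w < y%:Z.
  move=> ilt; apply/andP; split.
    rewrite leNgt; apply/negP => wi; have /= := later i.
    by lia.
  by rewrite ltNge; apply/negP => /least; lia.
apply: nS; exists n; rewrite /S chain_kill//; apply/le_anti.
rewrite yn andbT; case: n alive {yn least later} => [_|n alive].
  by rewrite /walk big_ord0.
by rewrite walkS; have := alive n (ltnSn n); lia.
Qed.

Hypotheses (hp : is_pmf p) (hp0 : 0 < p 0%N) (hC : iid_claims p C).
Context {v : R} {w : nat -> R}.
Hypotheses (v0 : 0 < v) (v1 : v < 1).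
Hypotheses (w0 : convolution p w 0 = 1) (wS : forall n, convolution p w n.+1 = w n / v).

Let w_gt0 n : 0 < w n := scale_gt0 hp hp0 v0 v1 w0 wS n.

(** The reward principle for the killed walk, with u(s) = w(s)/w(y) on [0,y) and
    0 elsewhere; the recursion of w is the equation for u. *)
Lemma exit_aboveE y : exit_above C v y%:Z = (w 0%N / w y)%:E.
Proof.
have wy := w_gt0 y.
have ext0 t : 0 <= zero_ext w t by case: t => // n; exact/ltW/w_gt0.
rewrite /exit_above unlock.
under eq_integral => a _ do rewrite /= exit_as_reward ?ltW//.
pose u s := if s < y%:Z then zero_ext w s / w y else 0.
pose r s : R := (s == y%:Z)%:R.
rewrite (discounted_rewards hC (kill y) 0 hp v 1 u r)//.
- rewrite /u /r; have [->|yn0] := eqVneq y 0%N.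
    by rewrite /= addr0 divff ?gt_eqF.
  by rewrite ltz_nat lt0n yn0 eqz_nat eq_sym (negbTE yn0) add0r.
- move=> s; rewrite /u; case: ifP => sy; last by rewrite lexx ler01.
  rewrite divr_ge0 ?(ltW wy)//= ler_pdivrMr// mul1r.
  case: s sy => [n|n] sy /=; last exact: ltW.
  by apply: (scale_nondecreasing hp hp0 v0 v1 w0 wS); lia.
move=> s; have [/andP[s0 sy]|out] := boolP (0 <= s < y%:Z); last first.
  rewrite eseries0.
    rewrite /u; case: s out => [n|n]; last by rewrite /= !mul0r.
    by rewrite -leNgt => yn; rewrite ltNge yn/= mul0r.
  by move=> k _ _; rewrite /kill (negbTE out) /u /r/= mul0r addr0 mulr0.
case: s s0 sy => // n _ sy.
rewrite /u sy/=.
under eq_eseriesr => k _.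
  have -> : u (kill y n k) + r (kill y n k)
      = (w y)^-1 * zero_ext w (n.+1%:Z - k%:Z).
    rewrite /kill sy /= /u /r.
    have -> : n%:Z + 1 - k%:Z = n.+1%:Z - k%:Z by lia.
    have [lt|gt|->] := ltgtP (n.+1%:Z - k%:Z) y%:Z; last first.
    - by rewrite /= mulVf ?gt_eqF// add0r.
    - by move: gt sy; lia.
    - by rewrite addr0 mulrC.
  rewrite mulrCA EFinM.
  over.
rewrite nneseriesZl; last first.
  by move=> k _; rewrite lee_fin mulr_ge0//; exact: hp.1.
rewrite (series_convolution hp); last by move=> k; exact/ltW/w_gt0.
by rewrite wS -EFinM; congr EFin; rewrite mulrA [_^-1 * _]mulrC.
Qed.

Lemma W_scale y : W p C v y%:Z = w y.
Proof.
rewrite /W exit_aboveE/= mulrA (scale0 w0).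
by rewrite mul1r invrK.
Qed.

(** This form holds for negative t as well, where the extension by zero gives
    the value 1. *)
Lemma Z_scale t :
  Z p C v t = 1 + (v^-1 - 1) * zero_ext (fun n => \sum_(0 <= y < n) w y) t.
Proof.
case: t => [n|n]; last by rewrite /= mulr0 addr0.
by rewrite /Z /zero_ext; under eq_bigr do rewrite W_scale.
Qed.

Let c0 : 0 < v^-1 - 1.
Proof. by rewrite subr_gt0 invf_gt1. Qed.

Lemma ext_sum_ge0 t : 0 <= zero_ext (fun n => \sum_(0 <= y < n) w y) t.
Proof. by case: t => //= n; apply: sumr_ge0 => i _; exact/ltW/w_gt0. Qed.

Lemma Z_gt0 t : 0 < Z p C v t.
Proof.
rewrite Z_scale ltr_pwDl// mulr_ge0 ?(ltW c0)//; exact: ext_sum_ge0.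
Qed.

Lemma Z_nondecreasing (m n : nat) : (m <= n)%N -> Z p C v m%:Z <= Z p C v n%:Z.
Proof.
move=> mn; rewrite !Z_scale/= lerD2l ler_pM2l//.
rewrite [leRHS](big_cat_nat (leq0n m) mn)//= lerDl.
by apply: sumr_ge0 => i _; exact/ltW/w_gt0.
Qed.

Lemma fdiff_Z_gt0 b : 0 < fdiff (fun k => Z p C v k%:Z) b.
Proof.
rewrite /fdiff !Z_scale/= big_nat_recr//=.
by have := mulr_gt0 c0 (w_gt0 b); lra.
Qed.

(** The function Z_v is v-harmonic for the walk at every n >= 0. *)
Lemma series_Z (n : nat) :
  (\sum_(0 <= k <oo) (p k * Z p C v (n.+1%:Z - k%:Z))%:E
   = (Z p C v n%:Z / v)%:E)%E.
Proof.
have p0 k : 0 <= p k := hp.1 k.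
under eq_eseriesr do rewrite Z_scale mulrDr mulr1 mulrCA EFinD EFinM.
rewrite nneseriesD//; first last.
- move=> k _ _; rewrite -EFinM lee_fin mulr_ge0 ?(ltW c0)// mulr_ge0//.
  exact: ext_sum_ge0.
- by move=> k _ _; rewrite lee_fin.
rewrite hp.2 nneseriesZl; last first.
  by move=> k _; rewrite lee_fin mulr_ge0// ext_sum_ge0.
rewrite (series_convolution hp); last by move=> k; exact: (ext_sum_ge0 k%:Z).
rewrite (convolution_sum_scale w0 wS) Z_scale/= -EFinM -EFinD; congr EFin.
by field; rewrite gt_eqF.
Qed.

(** * Dividends of the doubly reflected process *)

(** The reward principle for the surplus before regulation, with
    u(s) = Z_v(s')/Delta Z_v(b), s' the regulated surplus.  Starting the chain
    at an arbitrary x includes the initial injection and dividend. *)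
Lemma expected_dividendsE (b : nat) (x : int) :
  expected_dividends C v b x =
  ((dividend b x)%:~R +
   Z p C v (regulate b x) / fdiff (fun k => Z p C v k%:Z) b)%:E.
Proof.
set D := fdiff _ b; have D0 : 0 < D by exact: fdiff_Z_gt0.
have regb s : exists2 n : nat, regulate b s = n%:Z & (n <= b)%N.
  by exists `|regulate b s|%N; rewrite /regulate /injection /dividend; lia.
pose F s k : int := regulate b s + 1 - k%:Z.
have pre l a : pre_reflected C b x l a = chain C F x l a.
  by elim: l => //= l ->.
rewrite /expected_dividends.
under eq_integral => a _.
  under eq_eseriesr => l _ do rewrite /dividend_at pre.
  over.
rewrite (discounted_rewards hC F x hp v (Z p C v b / D)
  (fun s => Z p C v (regulate b s) / D) (fun s => (dividend b s)%:~R))//.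
- move=> s; have [n -> nb] := regb s.
  apply/andP; split; first by rewrite ltW// divr_gt0// Z_gt0.
  by rewrite ler_pM2r ?invr_gt0//; exact: Z_nondecreasing.
- by move=> s; rewrite ler0z /dividend; lia.
move=> s; rewrite /F; have [n -> nb] := regb s.
under eq_eseriesr => k _.
  have -> : Z p C v (regulate b (n%:Z + 1 - k%:Z)) / D
      + (dividend b (n%:Z + 1 - k%:Z))%:~R
      = D^-1 * Z p C v (n.+1%:Z - k%:Z).
    have -> : n%:Z + 1 - k%:Z = n.+1%:Z - k%:Z by lia.
    (* From a regulated surplus at most b, the next state is at most b + 1. *)
    have [neg|tb|E] : [\/ n.+1%:Z - k%:Z < 0, 0 <= n.+1%:Z - k%:Z <= b%:Z
        | n.+1%:Z - k%:Z = b.+1%:Z].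
      by case: (ltP (n.+1%:Z - k%:Z) 0); case: (leP (n.+1%:Z - k%:Z) b%:Z);
        (constructor 1 + constructor 2 + constructor 3); lia.
    - rewrite (_ : dividend _ _ = 0); last by rewrite /dividend; lia.
      rewrite (_ : regulate _ _ = 0); last first.
        by rewrite /regulate /injection /dividend; lia.
      rewrite addr0 mulrC; case: (n.+1%:Z - k%:Z) neg => //= *.
      by rewrite big_geq// mulr0 addr0.
    - rewrite (_ : dividend _ _ = 0); last by rewrite /dividend; lia.
      rewrite (_ : regulate _ _ = n.+1%:Z - k%:Z); last first.
        by rewrite /regulate /injection /dividend; lia.
      by rewrite addr0 mulrC.
    - rewrite E (_ : dividend _ _ = 1); last by rewrite /dividend; lia.
      rewrite (_ : regulate _ _ = b%:Z); last first.
        by rewrite /regulate /injection /dividend; lia.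
      have -> : Z p C v b.+1%:Z = Z p C v b%:Z + D by rewrite /D /fdiff; ring.
      by rewrite mulrDr mulVf ?gt_eqF// mulrC.
  rewrite mulrCA EFinM.
  over.
rewrite nneseriesZl; last first.
  by move=> k _; rewrite lee_fin mulr_ge0 ?(ltW (Z_gt0 _))//; exact: hp.1.
by rewrite series_Z -EFinM; congr EFin; rewrite mulrA [_^-1 * _]mulrC.
Qed.

End exit.

Theorem mainTheorem5 (d : measure_display) (T : measurableType d)
    (R : realType) (P : probability T R) (p : nat -> R)
    (C : nat -> {RV P >-> nat})
    (hp : is_pmf p) (hp0 : 0 < p 0%N) (hC : iid_claims p C)
    (hmean : ('E_P[(fun w => (C 0%N w)%:R)%R] < +oo)%E)
    (v : R) (hv0 : 0 < v) (hv1 : v < 1) (b : nat) (x : int) :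
  expected_dividends C v b x =
    if x <= b%:Z then
      (Z p C v x / fdiff (fun k : nat => Z p C v k%:Z) b)%:E
    else (((x - b%:Z)%:~R)%:E + expected_dividends C v b b%:Z)%E.
Proof.
have [w [w0 wS]] := scale_exists hp0 v.
rewrite !(expected_dividendsE hp hp0 hC hv0 hv1 w0 wS).
have regE t : 0 <= t <= b%:Z -> regulate b t = t /\ dividend b t = 0.
  by rewrite /regulate /injection /dividend; lia.
case: ifPn => [xb|]; last first.
  rewrite -ltNge => xb; have [-> ->] := regE b%:Z ltac:(lia).
  rewrite (_ : dividend b x = x - b%:Z); last by rewrite /dividend; lia.
  rewrite (_ : regulate b x = b%:Z); last first.
    by rewrite /regulate /injection /dividend; lia.
  by rewrite add0r.
case: x xb => [n|n] xb; first by have [|-> ->] := regE n%:Z; rewrite ?add0r.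
rewrite (_ : dividend _ _ = 0); last by rewrite /dividend NegzE; lia.
rewrite (_ : regulate _ _ = 0); last first.
  by rewrite /regulate /injection /dividend NegzE; lia.
by rewrite add0r/= big_geq// mulr0 addr0.
Qed.
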